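(* Let $\mathcal{D}$ be an abelian category with a distinguished Giraud subcategory $\mathcal{C}$, given by $(\mathcal{D},\mathcal{C},l,i)$, and let $\mathcal{S}=\mathrm{Ker}(l)$. There exists a one-to-one correspondence between torsion pairs $(\mathcal{X},\mathcal{Y})$ on $\mathcal{D}$ satisfying $il(\mathcal{Y})\subseteq\mathcal{Y}\subseteq\mathcal{S}^\bot$ and torsion pairs $(\mathcal{T},\mathcal{F})$ on $\mathcal{C}$.
   Context: An abelian category with a distinguished Giraud subcategory is the data $(\mathcal{D},\mathcal{C},l,i)$ of two abelian categories $\mathcal{D},\mathcal{C}$ and two adjoint functors $l:\mathcal{D}\to\mathcal{C}$, $i:\mathcal{C}\to\mathcal{D}$, with $l$ left adjoint of $i$, such that $l$ is exact and $i$ is fully faithful. $\mathrm{Ker}(l)$ is the full subcategory of objects $S$ of $\mathcal{D}$ with $l(S)\cong 0$, and $\mathcal{S}^\bot$ is the full subcategory $\{D\in\mathcal{D}\mid \mathrm{Hom}_{\mathcal{D}}(S,D)=0\ \forall S\in\mathcal{S}\}$. A torsion class in an abelian category $\mathcal{A}$ is a full subcategory closed under taking inductive limits and extensions; a torsion-free class is a full subcategory closed under taking projective limits and extensions. A torsion pair $(\mathcal{T},\mathcal{F})$ on $\mathcal{A}$ consists of a torsion class $\mathcal{T}$ and a torsion-free class $\mathcal{F}$ such that $\mathrm{Hom}_{\mathcal{A}}(T,F)=0$ for all $T\in\mathcal{T}$, $F\in\mathcal{F}$, and every object $A$ of $\mathcal{A}$ is the middle term of a short exact sequence $0\to T\to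 A\to F\to 0$ with $T\in\mathcal{T}$, $F\in\mathcal{F}$. The condition $il(\mathcal{Y})\subseteq\mathcal{Y}$ means $i(l(Y))\in\mathcal{Y}$ for all $Y\in\mathcal{Y}$. *)

(* Defs.v *)
From HB Require Import structures.
From mathcomp Require Import all_boot all_algebra.
From mathcomp Require Import boolp classical_sets functions.

Set Implicit Arguments.
Unset Strict Implicit.
Unset Printing Implicit Defensive.
Import GRing.Theory.
Local Open Scope ring_scope.
Local Open Scope classical_set_scope.

Record category := Category {
  obj :> Type;
  hom : obj -> obj -> Type;
  idm : forall A, hom A A;
  comp : forall A B C, hom B C -> hom A B -> hom A C;
  comp_idl : forall A B (f : hom A B), comp (idm B) f = f;
  comp_idr : forall A B (f : hom A B), comp f (idm A) = f;
  compA : forall A B C D (h : hom C D) (g : hom B C) (f : hom A B),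
    comp h (comp g f) = comp (comp h g) f }.

Arguments hom {c} A B.
Arguments idm {c} A.
Notation "g '\;c' f" := (comp g f) (at level 40, left associativity).

Record functor (C D : category) := Functor {
  fobj :> C -> D;
  fmap : forall A B : C, hom A B -> hom (fobj A) (fobj B);
  fmap_id : forall A : C, fmap (idm A) = idm (fobj A);
  fmap_comp : forall (A B E : C) (g : hom B E) (f : hom A B),
    fmap (g \;c f) = fmap g \;c fmap f }.

Definition fully_faithful (C D : category) (F : functor C D) : Prop :=
  forall A B : C, bijective (fmap F (A := A) (B := B)).

Record adjunction (C D : category) (l : functor D C) (i : functor C D) :=
  Adjunction {
  adj : forall (A : D) (B : C), hom (l A) B -> hom A (i B);
  adj_bij : forall (A : D) (B : C), bijective (adj (A := A) (B := B));
  adj_natl : forall (A A' : D) (B : C) (f : hom (l A) B) (a : hom A' A),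
    adj (f \;c fmap l a) = adj f \;c a;
  adj_natr : forall (A : D) (B B' : C) (b : hom B B') (f : hom (l A) B),
    adj (b \;c f) = fmap i b \;c adj f }.

Section CategoryNotions.
Variable C : category.

Definition isomorphic (A B : C) : Prop :=
  exists (f : hom A B) (g : hom B A), g \;c f = idm A /\ f \;c g = idm B.

Definition monic (A B : C) (f : hom A B) : Prop :=
  forall (X : C) (u v : hom X A), f \;c u = f \;c v -> u = v.

Definition epic (A B : C) (f : hom A B) : Prop :=
  forall (X : C) (u v : hom B X), u \;c f = v \;c f -> u = v.

Definition zero_object (Z : C) : Prop :=
  forall A : C, (exists! f : hom Z A, True) /\ (exists! f : hom A Z, True).

Definition cocone (J : category) (F : functor J C) (A : C)
    (c : forall j : J, hom (F j) A) : Prop :=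
  forall (j k : J) (u : hom j k), c k \;c fmap F u = c j.

Definition is_colimit (J : category) (F : functor J C) (A : C)
    (c : forall j : J, hom (F j) A) : Prop :=
  cocone c /\ forall (B : C) (d : forall j : J, hom (F j) B), cocone d ->
    exists! u : hom A B, forall j, u \;c c j = d j.

Definition cone (J : category) (F : functor J C) (A : C)
    (c : forall j : J, hom A (F j)) : Prop :=
  forall (j k : J) (u : hom j k), fmap F u \;c c j = c k.

Definition is_limit (J : category) (F : functor J C) (A : C)
    (c : forall j : J, hom A (F j)) : Prop :=
  cone c /\ forall (B : C) (d : forall j : J, hom B (F j)), cone d ->
    exists! u : hom B A, forall j, c j \;c u = d j.

(* A full subcategory is given by its set of objects, so a diagram in it is a
   diagram in [C] whose objects all lie in that set.  [C] need not be
   (co)complete: only the (co)limits that exist in [C] are considered.  Any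
   object carrying a universal (co)cone counts as the (co)limit; hence a
   closed [P] contains every object isomorphic to one of its members. *)
Definition closed_colimits (P : set C) : Prop :=
  forall (J : category) (F : functor J C) (A : C)
    (c : forall j : J, hom (F j) A),
    is_colimit c -> (forall j, P (F j)) -> P A.

Definition closed_limits (P : set C) : Prop :=
  forall (J : category) (F : functor J C) (A : C)
    (c : forall j : J, hom A (F j)),
    is_limit c -> (forall j, P (F j)) -> P A.

End CategoryNotions.

Record zmodCategory := ZmodCategory {
  zmodcat_cat :> category;
  hom_zmod : forall A B : zmodcat_cat, GRing.Zmodule (hom A B) }.

HB.instance Definition _ (D : zmodCategory) (A B : D) := hom_zmod A B.

Section ZmodCategoryNotions.
Variable D : zmodCategory.

Definition is_kernel (A B C : D) (g : hom B C) (k : hom A B) : Prop :=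
  g \;c k = 0 /\ forall (X : D) (h : hom X B), g \;c h = 0 ->
    exists! u : hom X A, k \;c u = h.

Definition is_cokernel (A B C : D) (f : hom A B) (q : hom B C) : Prop :=
  q \;c f = 0 /\ forall (X : D) (h : hom B X), h \;c f = 0 ->
    exists! u : hom C X, u \;c q = h.

Definition is_biproduct (A B P : D) (i1 : hom A P) (i2 : hom B P)
    (p1 : hom P A) (p2 : hom P B) : Prop :=
  [/\ p1 \;c i1 = idm A, p2 \;c i2 = idm B, p2 \;c i1 = 0, p1 \;c i2 = 0
    & i1 \;c p1 + i2 \;c p2 = idm P].

(* Exactness of 0 -> A -> B -> C -> 0. *)
Definition short_exact (A B C : D) (f : hom A B) (g : hom B C) : Prop :=
  is_kernel g f /\ is_cokernel f g.

End ZmodCategoryNotions.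

Record abelian := Abelian {
  abelian_cat :> zmodCategory;
  compDl : forall (A B C : abelian_cat) (g h : hom B C) (f : hom A B),
    (g + h) \;c f = g \;c f + h \;c f;
  compDr : forall (A B C : abelian_cat) (g : hom B C) (f h : hom A B),
    g \;c (f + h) = g \;c f + g \;c h;
  has_zero : exists Z : abelian_cat, zero_object Z;
  has_biproducts : forall A B : abelian_cat,
    exists (P : abelian_cat) (i1 : hom A P) (i2 : hom B P)
      (p1 : hom P A) (p2 : hom P B), is_biproduct i1 i2 p1 p2;
  has_kernels : forall (B C : abelian_cat) (g : hom B C),
    exists (A : abelian_cat) (k : hom A B), is_kernel g k;
  has_cokernels : forall (A B : abelian_cat) (f : hom A B),
    exists (C : abelian_cat) (q : hom B C), is_cokernel f q;
  monic_normal : forall (A B : abelian_cat) (f : hom A B), monic f ->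
    exists (C : abelian_cat) (g : hom B C), is_kernel g f;
  epic_normal : forall (B C : abelian_cat) (g : hom B C), epic g ->
    exists (A : abelian_cat) (f : hom A B), is_cokernel f g }.

Definition exact_functor (D C : abelian) (F : functor D C) : Prop :=
  (forall (A B : D) (f g : hom A B), fmap F (f + g) = fmap F f + fmap F g) /\
  (forall (A B E : D) (f : hom A B) (g : hom B E),
    short_exact f g -> short_exact (fmap F f) (fmap F g)).

Definition Ker (D C : abelian) (F : functor D C) : set D :=
  [set S | exists2 Z : C, zero_object Z & isomorphic (F S) Z].

Section Torsion.
Variable A : abelian.

Definition right_orth (S : set A) : set A :=
  [set D | forall X : A, S X -> forall f : hom X D, f = 0].

Definition closed_extensions (P : set A) : Prop :=
  forall (X Y Z : A) (f : hom X Y) (g : hom Y Z),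
    short_exact f g -> P X -> P Z -> P Y.

Definition torsion_class (T : set A) : Prop :=
  closed_colimits T /\ closed_extensions T.

Definition torsion_free_class (F : set A) : Prop :=
  closed_limits F /\ closed_extensions F.

Definition torsion_pair (T F : set A) : Prop :=
  [/\ torsion_class T,
      torsion_free_class F,
      forall X Y : A, T X -> F Y -> forall f : hom X Y, f = 0
    & forall X : A, exists (TX FX : A) (f : hom TX X) (g : hom X FX),
        [/\ T TX, F FX & short_exact f g]].

End Torsion.

(* Main.v *)
(** The correspondence pulls torsion pairs back along [i]: [(X, Y)] goes to
    [(i^-1 X, i^-1 Y)], and the preimage of [(T, F)] is
    [(l^-1 T, l^-1 F `&` (Ker l)^bot)].  It works because the two halves of a
    torsion pair are the orthogonals of each other, the counit [l i -> 1] is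
    an isomorphism, and the kernel of the unit [A -> i l A] lies in [Ker l], so
    that the unit is monic on objects of [(Ker l)^bot]. *)
Require Import Defs.
From mathcomp Require Import all_boot all_algebra.
From mathcomp Require Import boolp classical_sets functions.
Local Open Scope classical_set_scope.

Set Implicit Arguments.
Unset Strict Implicit.
Unset Printing Implicit Defensive.
(* [functions] shadows [comp] and [compA] of [Defs]. *)
Import GRing.Theory Defs.
Local Open Scope ring_scope.

(** * Closure under isomorphism, from diagrams with one object *)

Section OneObjectDiagram.
Variable C : category.

Definition unit_category : category.
Proof.
refine (@Category unit (fun _ _ => unit) (fun _ => tt)
  (fun _ _ _ _ _ => tt) _ _ _) => // ? ? [] //.
Defined.

Definition const_functor (A : C) : functor unit_category C.
Proof.
by refine (@Functor unit_category C (fun _ => A) (fun _ _ _ => idm A) _ _)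
  => // *; rewrite comp_idl.
Defined.

(** An isomorphism [f] is by itself a colimit cocone over the constant diagram at [A]: a cocone [d]
    factors uniquely through it as [d tt \;c g]. *)
Lemma closed_colimits_iso (P : set C) (A B : C) :
  closed_colimits P -> isomorphic A B -> P A -> P B.
Proof.
move=> cP [f [g [gf fg]]] PA.
apply: (cP unit_category (const_functor A) B (fun _ => f)) => //.
split=> [j k u /=|X d cd]; first by rewrite comp_idr.
exists (d tt \;c g); split=> [[]|u' /(_ tt) <-].
  by rewrite -compA gf comp_idr.
by rewrite -compA fg comp_idr.
Qed.

Lemma closed_limits_iso (P : set C) (A B : C) :
  closed_limits P -> isomorphic A B -> P A -> P B.
Proof.
move=> cP [f [g [gf fg]]] PA.
apply: (cP unit_category (const_functor A) B (fun _ => g)) => //.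
split=> [j k u /=|X d cd]; first by rewrite comp_idl.
exists (f \;c d tt); split=> [[]|u' /(_ tt) <-].
  by rewrite compA gf comp_idl.
by rewrite compA fg comp_idl.
Qed.

End OneObjectDiagram.

Lemma isomorphic_sym (C : category) (A B : C) :
  isomorphic A B -> isomorphic B A.
Proof. by move=> [f [g [gf fg]]]; exists g, f. Qed.

(** * Kernels, cokernels and images in an abelian category *)

Section AbelianFacts.
Variable A : abelian.
Implicit Types X Y Z W : A.

Lemma comp0 X Y Z (f : hom X Y) : (0 : hom Y Z) \;c f = 0.
Proof. by apply: (addrI (0 \;c f)); rewrite -compDl !addr0. Qed.

Lemma compr0 X Y Z (g : hom Y Z) : g \;c (0 : hom X Y) = 0.
Proof. by apply: (addrI (g \;c 0)); rewrite -compDr !addr0. Qed.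

Lemma compNr X Y Z (g : hom Y Z) (f : hom X Y) : g \;c (- f) = - (g \;c f).
Proof. by apply/eqP; rewrite -addr_eq0 -compDr addNr compr0. Qed.

Lemma compNl X Y Z (g : hom Y Z) (f : hom X Y) : (- g) \;c f = - (g \;c f).
Proof. by apply/eqP; rewrite -addr_eq0 -compDl addNr comp0. Qed.

Lemma monicP X Y (f : hom X Y) :
  (forall W (u : hom W X), f \;c u = 0 -> u = 0) -> monic f.
Proof.
move=> fI W u v fuv; apply/eqP; rewrite -subr_eq0; apply/eqP/fI.
by rewrite compDr compNr fuv subrr.
Qed.

Lemma epicP X Y (f : hom X Y) :
  (forall W (u : hom Y W), u \;c f = 0 -> u = 0) -> epic f.
Proof.
move=> fI W u v fuv; apply/eqP; rewrite -subr_eq0; apply/eqP/fI.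
by rewrite compDl compNl fuv subrr.
Qed.

Lemma monic0 X Y Z (f : hom X Y) (u : hom Z X) :
  monic f -> f \;c u = 0 -> u = 0.
Proof. by move=> fM fu; apply: fM; rewrite fu compr0. Qed.

Lemma kernel_monic X Y Z (g : hom Y Z) (k : hom X Y) :
  is_kernel g k -> monic k.
Proof.
move=> [gk kU]; apply: monicP => W u ku.
have [v [_ vU]] := kU W 0 (compr0 _ _).
by rewrite -(vU _ ku) -(vU 0 (compr0 _ _)).
Qed.

Lemma cokernel_epic X Y Z (f : hom X Y) (q : hom Y Z) :
  is_cokernel f q -> epic q.
Proof.
move=> [qf qU]; apply: epicP => W u uq.
have [v [_ vU]] := qU W 0 (comp0 _ _).
by rewrite -(vU _ uq) -(vU 0 (comp0 _ _)).
Qed.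

Lemma kernel_lift X Y Z W (g : hom Y Z) (k : hom X Y) (h : hom W Y) :
  is_kernel g k -> g \;c h = 0 -> exists u, k \;c u = h.
Proof. by move=> [_ kU] /kU [u [ku _]]; exists u. Qed.

Lemma cokernel_desc X Y Z W (f : hom X Y) (q : hom Y Z) (h : hom Y W) :
  is_cokernel f q -> h \;c f = 0 -> exists u, u \;c q = h.
Proof. by move=> [_ qU] /qU [u [uq _]]; exists u. Qed.

Lemma is_kernelI X Y Z (g : hom Y Z) (k : hom X Y) :
  monic k -> g \;c k = 0 ->
  (forall W (h : hom W Y), g \;c h = 0 -> exists u, k \;c u = h) ->
  is_kernel g k.
Proof.
move=> kM gk kU; split=> // W h /kU [u ku].
by exists u; split=> // u' ku'; apply: kM; rewrite ku ku'.
Qed.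

Lemma is_cokernelI X Y Z (f : hom X Y) (q : hom Y Z) :
  epic q -> q \;c f = 0 ->
  (forall W (h : hom Y W), h \;c f = 0 -> exists u, u \;c q = h) ->
  is_cokernel f q.
Proof.
move=> qE qf qU; split=> // W h /qU [u uq].
by exists u; split=> // u' uq'; apply: qE; rewrite uq uq'.
Qed.

Lemma kernel_iso X X' Y Z (g : hom Y Z) (k : hom X Y) (k' : hom X' Y) :
  is_kernel g k -> is_kernel g k' -> isomorphic X X'.
Proof.
move=> kK kK'.
have [u ku] := kernel_lift kK' kK.1; have [v kv] := kernel_lift kK kK'.1.
exists u, v; split.
  by apply: (kernel_monic kK); rewrite compA kv ku comp_idr.
by apply: (kernel_monic kK'); rewrite compA ku kv comp_idr.
Qed.

Lemma kernel_comp_monic X Y Z W (g : hom Y Z) (k : hom X Y) (m : hom Z W) :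
  monic m -> is_kernel g k -> is_kernel (m \;c g) k.
Proof.
move=> mM kK; apply: is_kernelI; first exact: kernel_monic kK.
  by rewrite -compA kK.1 compr0.
by move=> V h; rewrite -compA => /(monic0 mM); apply: kernel_lift kK.
Qed.

(** By normality [m] is the kernel of some [g], and [g] factors through the cokernel [q] of [m]; so
    a map killed by [q] is killed by [g] and lifts through [m]. *)
Lemma monic_short_exact X Y (m : hom X Y) :
  monic m -> exists Z (q : hom Y Z), short_exact m q.
Proof.
move=> mM; have [Z [g mK]] := monic_normal mM.
have [Q [q qC]] := has_cokernels m; exists Q, q; split=> //.
apply: is_kernelI => // [|W h qh]; first exact: qC.1.
have [v vq] := cokernel_desc qC mK.1.
by apply: (kernel_lift mK); rewrite -vq -compA qh compr0.
Qed.

Lemma epic_cokernel X Y Z (g : hom Y Z) (k : hom X Y) :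
  epic g -> is_kernel g k -> is_cokernel k g.
Proof.
move=> gE kK; have [W [f gC]] := epic_normal gE.
apply: is_cokernelI => // [|V h hk]; first exact: kK.1.
have [v kv] := kernel_lift kK gC.1.
by apply: (cokernel_desc gC); rewrite -kv compA hk comp0.
Qed.

Lemma image_short_exact X Y (g : hom X Y) :
  exists K I (k : hom K X) (e : hom X I) (m : hom I Y),
    [/\ monic m, g = m \;c e & short_exact k e].
Proof.
have [Q [c cC]] := has_cokernels g.
have [I [m mK]] := has_kernels c; have mM := kernel_monic mK.
have [e me] := kernel_lift mK cC.1.
have [K [k kK]] := has_kernels e.
exists K, I, k, e, m; split=> //; split=> //; apply: epic_cokernel => //.
apply: epicP => W h he.
(* [g] factors through [m \;c n], the kernel of some [p]; then [p] factors
   through [c = coker g], hence kills [m], which makes [n] split epic. *)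
have [N [n nK]] := has_kernels h.
have [f nf] := kernel_lift nK he.
have mnM : monic (m \;c n).
  by move=> V u v; rewrite -!compA => /mM /(kernel_monic nK).
have [P [p pK]] := monic_normal mnM.
have [p' p'c] : exists p', p' \;c c = p.
  by apply: (cokernel_desc cC); rewrite -me -nf !compA -(compA p) pK.1 comp0.
have [t mnt] : exists t, m \;c n \;c t = m.
  by apply: (kernel_lift pK); rewrite -p'c -compA mK.1 compr0.
have nt : n \;c t = idm I by apply: mM; rewrite compA mnt comp_idr.
by rewrite -[h]comp_idr -nt compA nK.1 comp0.
Qed.

(** Turns the universal property into an equation, the form in which membership in [Ker l] is
    tested. *)
Lemma zero_objectP Z : zero_object Z <-> idm Z = 0.
Proof.
split=> [Z0|Z0 B].
  by have [_ [f [_ fU]]] := Z0 Z; rewrite -(fU (idm Z) I) -(fU 0 I).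
split; exists 0; split=> // f _.
  by rewrite -[f]comp_idr Z0 compr0.
by rewrite -[f]comp_idl Z0 comp0.
Qed.

Lemma short_exact_iso X Y Y' Z (f : hom X Y) (g : hom Y Z)
    (u : hom Y Y') (v : hom Y' Y) :
  v \;c u = idm Y -> u \;c v = idm Y' ->
  short_exact f g -> short_exact (u \;c f) (g \;c v).
Proof.
move=> vu uv [fK gC].
have gf : (g \;c v) \;c (u \;c f) = 0.
  by rewrite compA -(compA g) vu comp_idr fK.1.
split.
  apply: is_kernelI => // [W a b|W h].
    move/(congr1 (comp v)); rewrite !compA vu !comp_idl.
    exact: (kernel_monic fK).
  rewrite -compA => /(kernel_lift fK) [w fw].
  by exists w; rewrite -compA fw compA uv comp_idl.
apply: is_cokernelI => // [W a b|W h].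
  move/(congr1 (fun h => h \;c u)).
  rewrite -!compA vu comp_idr; exact: (cokernel_epic gC).
rewrite compA => /(cokernel_desc gC) [w wg].
by exists w; rewrite compA wg -compA uv comp_idr.
Qed.

End AbelianFacts.

(** * Torsion pairs as pairs of mutually orthogonal classes *)

Section TorsionPairs.
Variable A : abelian.
Implicit Types T F : set A.

Definition left_orth F : set A :=
  [set X | forall Y : A, F Y -> forall f : hom X Y, f = 0].

(** A map from a colimit that vanishes on every leg is the one induced by the zero cocone. A map
    from an extension that vanishes on the subobject factors through the quotient. *)
Lemma left_orth_torsion F : torsion_class (left_orth F).
Proof.
split.
  move=> J G X c [cc cU] cF Y FY f.
  have d0 : cocone (fun j => 0 : hom (G j) Y) by move=> *; exact: comp0.
  have [u [_ uU]] := cU Y _ d0.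
  rewrite -(uU f); first by apply: uU => j; exact: comp0.
  by move=> j; exact: cF.
move=> X Y Z f g [_ gC] oX oZ W FW h.
have [u <-] := cokernel_desc gC (oX W FW (h \;c f)).
by rewrite (oZ W FW u) comp0.
Qed.

Lemma right_orth_torsion_free T : torsion_free_class (right_orth T).
Proof.
split.
  move=> J G X c [cc cU] cT Y TY f.
  have d0 : cone (fun j => 0 : hom Y (G j)) by move=> *; exact: compr0.
  have [u [_ uU]] := cU Y _ d0.
  rewrite -(uU f); first by apply: uU => j; exact: compr0.
  by move=> j; exact: cT.
move=> X Y Z f g [fK _] oX oZ W TW h.
have [u <-] := kernel_lift fK (oZ W TW (g \;c h)).
by rewrite (oX W TW u) compr0.
Qed.

Lemma left_orth_iso F X Y : isomorphic X Y -> left_orth F X -> left_orth F Y.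
Proof. exact: closed_colimits_iso (left_orth_torsion F).1. Qed.

Lemma right_orth_iso T X Y :
  isomorphic X Y -> right_orth T X -> right_orth T Y.
Proof. exact: closed_limits_iso (right_orth_torsion_free T).1. Qed.

Lemma right_orth_sub T (X Y : A) (m : hom X Y) :
  monic m -> right_orth T Y -> right_orth T X.
Proof. by move=> mM oY Z TZ f; apply: (monic0 mM); exact: oY TZ _. Qed.

Lemma orthogonal_decomposition T F :
  (forall X Y : A, isomorphic X Y -> T X -> T Y) ->
  (forall X Y : A, isomorphic X Y -> F X -> F Y) ->
  (forall X Y : A, T X -> F Y -> forall f : hom X Y, f = 0) ->
  (forall X : A, exists (TX FX : A) (f : hom TX X) (g : hom X FX),
     [/\ T TX, F FX & short_exact f g]) ->
  T = left_orth F /\ F = right_orth T.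
Proof.
move=> Tiso Fiso TF0 dec; split.
  apply/seteqP; split=> [X TX Y FY f|X oX]; first exact: TF0 TX FY f.
  have [TX [FX [f [g [hT hF [fK gC]]]]]] := dec X.
  (* With [g] zero, its kernel [f] is a split monomorphism onto [X], so [X] is isomorphic to
     [TX]. *)
  have g0 : g = 0 by exact: oX.
  have [s fs] : exists s, f \;c s = idm X.
    by apply: (kernel_lift fK); rewrite g0 comp0.
  apply: (Tiso TX) => //; exists f, s; split=> //.
  by apply: (kernel_monic fK); rewrite compA fs comp_idl comp_idr.
apply/seteqP; split=> [Y FY X TX f|X oX]; first exact: TF0 TX FY f.
have [TX [FX [f [g [hT hF [fK gC]]]]]] := dec X.
have f0 : f = 0 by exact: oX.
have [s sg] : exists s, s \;c g = idm X.
  by apply: (cokernel_desc gC); rewrite f0 compr0.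
apply: (Fiso FX) => //; exists s, g; split=> //.
by apply: (cokernel_epic gC); rewrite -compA sg comp_idl comp_idr.
Qed.

(** Closure under (co)limits and extensions comes for free, since the two classes turn out to be
    orthogonals of each other. *)
Lemma torsion_pairI T F :
  (forall X Y : A, isomorphic X Y -> T X -> T Y) ->
  (forall X Y : A, isomorphic X Y -> F X -> F Y) ->
  (forall X Y : A, T X -> F Y -> forall f : hom X Y, f = 0) ->
  (forall X : A, exists (TX FX : A) (f : hom TX X) (g : hom X FX),
     [/\ T TX, F FX & short_exact f g]) ->
  torsion_pair T F.
Proof.
move=> Tiso Fiso TF0 dec.
have [TE FE] := orthogonal_decomposition Tiso Fiso TF0 dec.
split=> //.
  by rewrite TE; exact: left_orth_torsion.
by rewrite FE; exact: right_orth_torsion_free.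
Qed.

Lemma torsion_pair_orth T F :
  torsion_pair T F -> T = left_orth F /\ F = right_orth T.
Proof.
move=> [[cT _] [cF _] TF0 dec].
apply: orthogonal_decomposition => // X Y.
  exact: closed_colimits_iso cT.
exact: closed_limits_iso cF.
Qed.

End TorsionPairs.

Lemma fmap_iso (C D : category) (F : functor C D) (A B : C) :
  isomorphic A B -> isomorphic (F A) (F B).
Proof.
move=> [f [g [gf fg]]]; exists (fmap F f), (fmap F g).
by rewrite -!fmap_comp gf fg !fmap_id.
Qed.

(** * Unit and counit of the Giraud adjunction *)

Section Giraud.
Variables (D C : abelian) (l : functor D C) (i : functor C D).
Variables (l_adj_i : adjunction l i) (l_exact : exact_functor l).
Hypothesis i_ff : fully_faithful i.

Let adj_inj (A : D) (B : C) : injective (adj l_adj_i (A := A) (B := B)).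
Proof. exact/bij_inj/adj_bij. Qed.

Let fmapi_inj (A B : C) : injective (fmap i (A := A) (B := B)).
Proof. exact/bij_inj/i_ff. Qed.

Lemma adj_surj (A : D) (B : C) (g : hom A (i B)) : exists f, adj l_adj_i f = g.
Proof. by have [h _ adjK] := adj_bij l_adj_i A B; exists (h g). Qed.

Lemma full (A B : C) (g : hom (i A) (i B)) : exists f, fmap i f = g.
Proof. by have [h _ iK] := i_ff A B; exists (h g). Qed.

Lemma fmapl0 (A B : D) : fmap l (0 : hom A B) = 0.
Proof.
by apply: (addrI (fmap l (0 : hom A B))); rewrite -l_exact.1 !addr0.
Qed.

(** Naturality replaces additivity of [adj]: precomposing with the zero map of [A] makes the
    transpose factor through zero. *)
Lemma adj0 (A : D) (B : C) : adj l_adj_i (0 : hom (l A) B) = 0.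
Proof.
by have := adj_natl l_adj_i (0 : hom (l A) B) (0 : hom A A);
  rewrite fmapl0 !compr0.
Qed.

Lemma fmapi0 (A B : C) : fmap i (0 : hom A B) = 0.
Proof.
have [e eE] := adj_surj (idm (i A)).
by have := adj_natr l_adj_i (0 : hom A B) e; rewrite eE comp_idr comp0 adj0.
Qed.

Lemma counit_iso (B : C) :
  exists (e : hom (l (i B)) B) (s : hom B (l (i B))),
    [/\ adj l_adj_i e = idm (i B), e \;c s = idm B & s \;c e = idm _].
Proof.
have [e eE] := adj_surj (idm (i B)).
(* The inverse [s] of the counit [e] is the map that fullness of [i] extracts from the unit at
   [i B]. *)
have [s sE] := full (adj l_adj_i (idm (l (i B)))).
exists e, s; split=> //.
  apply: fmapi_inj; rewrite fmap_comp sE fmap_id -eE.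
  by rewrite -adj_natr comp_idr.
by apply: adj_inj; rewrite adj_natr eE comp_idr sE.
Qed.

Lemma li_iso (B : C) : isomorphic (l (i B)) B.
Proof. by have [e [s [_ es se]]] := counit_iso B; exists e, s. Qed.

Definition unit_adj (A : D) : hom A (i (l A)) := adj l_adj_i (idm (l A)).

Lemma unit_nat (A B : D) (f : hom A B) :
  unit_adj B \;c f = adj l_adj_i (fmap l f).
Proof. by rewrite -adj_natl comp_idl. Qed.

(** A triangle identity: the retraction is the counit at [l A]. *)
Lemma fmapl_unit_retract (A : D) :
  exists r : hom (l (i (l A))) (l A), r \;c fmap l (unit_adj A) = idm (l A).
Proof.
have [e [s [eE _ _]]] := counit_iso (l A); exists e.
by apply: adj_inj; rewrite adj_natl eE comp_idl.
Qed.

Lemma KerP (X : D) : Ker l X <-> idm (l X) = 0.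
Proof.
split=> [[Z /zero_objectP Z0 [f [g [gf fg]]]]|X0].
  by rewrite -gf -[f]comp_idl Z0 comp0 compr0.
exists (l X); first exact/zero_objectP.
by exists (idm _), (idm _); rewrite comp_idl.
Qed.

Lemma right_orth_Ker_i (B : C) : right_orth (Ker l) (i B).
Proof.
move=> X /KerP X0 f; have [g <-] := adj_surj f.
by rewrite -[g]comp_idr X0 compr0 adj0.
Qed.

Lemma fmapl_monic (A B : D) (m : hom A B) : monic m -> monic (fmap l m).
Proof.
move=> /monic_short_exact [Z [q /l_exact.2 [mK _]]]; exact: kernel_monic mK.
Qed.

(** The image factorization puts the kernel [k] of the unit into a short exact sequence, so
    [fmap l k] is monic. It is also zero, because [l] makes the unit split monic; hence [K] lies in
    [Ker l] and [k] vanishes by orthogonality. *)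
Lemma unit_monic (A : D) : right_orth (Ker l) A -> monic (unit_adj A).
Proof.
have [K [I [k [e [m [mM uE kE]]]]]] := image_short_exact (unit_adj A).
have uk : unit_adj A \;c k = 0 by rewrite uE -compA kE.1.1 compr0.
move=> /(_ K) oA; have k0 : k = 0.
  apply: oA; apply/KerP.
  have [lkK _] := l_exact.2 _ _ _ _ _ kE.
  apply: (monic0 (kernel_monic lkK)); rewrite comp_idr.
  have [r rE] := fmapl_unit_retract A.
  by rewrite -[fmap l k]comp_idl -rE -compA -fmap_comp uk fmapl0 compr0.
apply: monicP => W u; rewrite uE -compA => /(monic0 mM) eu.
by have [v <-] := kernel_lift kE.1 eu; rewrite k0 comp0.
Qed.

(** * Transfer of torsion pairs between [D] and [C] *)

Lemma torsion_pair_restrict (X Y : set D) :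
  torsion_pair X Y -> (forall A, Y A -> Y (i (l A))) ->
  Y `<=` right_orth (Ker l) -> torsion_pair (X \o i) (Y \o i).
Proof.
move=> tXY Yil YS; have [XE YE] := torsion_pair_orth tXY.
have [_ _ XY0 dec] := tXY.
apply: torsion_pairI.
- by move=> A B /(fmap_iso i) AB /=; rewrite XE; exact: left_orth_iso.
- by move=> A B /(fmap_iso i) AB /=; rewrite YE; exact: right_orth_iso.
- move=> A B XA YB f; apply: fmapi_inj; rewrite fmapi0; exact: XY0 XA YB _.
move=> B; have [P [Q [f [g [XP YQ fg]]]]] := dec (i B).
have [e [s [_ es se]]] := counit_iso B.
(* The image under [l] of the decomposition of [i B], carried to [B] along the counit. *)
exists (l P), (l Q), (e \;c fmap l f), (fmap l g \;c s); split.
(* After the monic unit of [W], [h] becomes [fmap i h']; the transpose of [h'] goes from [P] in [X]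
   to [i (l W)] in [Y], hence is zero. *)
- rewrite /= XE => W YW h; apply: (monic0 (unit_monic (YS _ YW))).
  have [h' <-] := full (unit_adj W \;c h).
  suff -> : h' = 0 by exact: fmapi0.
  by apply: adj_inj; rewrite adj0; apply: XY0 XP (Yil _ YW) _.
- exact: Yil.
- by apply: short_exact_iso => //; exact: l_exact.2.
Qed.

Lemma torsion_pair_extend (T F : set C) :
  torsion_pair T F ->
  torsion_pair (T \o l) ((F \o l) `&` right_orth (Ker l)).
Proof.
move=> tTF; have [TE FE] := torsion_pair_orth tTF.
have [_ _ TF0 dec] := tTF.
apply: torsion_pairI.
- by move=> A B /(fmap_iso l) AB /=; rewrite TE; exact: left_orth_iso.
- move=> A B AB [/= FA SA]; split; last exact: right_orth_iso AB SA.
  by move: FA; rewrite /= FE; apply/right_orth_iso/fmap_iso.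
- move=> A B TA [FB SB] f; apply: (monic0 (unit_monic SB)).
  by rewrite unit_nat (TF0 _ _ TA FB (fmap l f)) adj0.
move=> A; have [P [Q [t [p [TP FQ [tK pC]]]]]] := dec (l A).
(* The transpose of [p] maps [A] to [i Q]; its kernel [K] and image [I] are the torsion and
   torsion-free parts of [A]. *)
have [K [I [k [e [m [mM gE kE]]]]]] := image_short_exact (adj l_adj_i p).
have [c [s [cE cs sc]]] := counit_iso Q.
(* Transposing back, [p] factors through [l I], which embeds in [Q]; hence [fmap l k] is again a
   kernel of [p], and [l K] is isomorphic to [P]. *)
have pE : p = (c \;c fmap l m) \;c fmap l e.
  by apply: adj_inj; rewrite -compA -fmap_comp -gE adj_natl cE comp_idl.
have cmM : monic (c \;c fmap l m).
  move=> W u v /(congr1 (comp s)); rewrite !compA sc !comp_idl.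
  exact: fmapl_monic.
have [lkK _] := l_exact.2 _ _ _ _ _ kE.
exists K, I, k, e; split=> //.
  have lkP : is_kernel p (fmap l k) by rewrite pE; exact: kernel_comp_monic.
  by move: TP; rewrite /= TE; apply: left_orth_iso; exact: kernel_iso tK lkP.
split; last exact: right_orth_sub mM (@right_orth_Ker_i Q).
by move: FQ; rewrite /= FE; exact: right_orth_sub cmM.
Qed.

(** Recovers [Y] from its restriction. An object [A] of the right-hand side embeds by the unit in
    [i (l A)], and [Y], being a right orthogonal, is closed under subobjects. *)
Lemma torsion_free_restrictK (X Y : set D) :
  torsion_pair X Y -> (forall A, Y A -> Y (i (l A))) ->
  Y `<=` right_orth (Ker l) ->
  Y = (Y \o i \o l) `&` right_orth (Ker l).
Proof.
move=> /torsion_pair_orth [_ YE] Yil YS.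
apply/seteqP; split=> [A YA|A [/= YA SA]].
  by split; [exact: Yil | exact: YS].
by move: YA; rewrite YE; apply/right_orth_sub/unit_monic.
Qed.

End Giraud.

Theorem theorem3p4 (D C : abelian) (l : functor D C) (i : functor C D)
    (l_adj_i : adjunction l i) (l_exact : exact_functor l)
    (i_ff : fully_faithful i) :
  exists phi : set D * set D -> set C * set C,
    set_bij
      [set XY : set D * set D |
        [/\ torsion_pair XY.1 XY.2,
            (forall Y : D, XY.2 Y -> XY.2 (i (l Y)))
          & XY.2 `<=` right_orth (Ker l)]]
      [set TF : set C * set C | torsion_pair TF.1 TF.2]
      phi.
Proof.
exists (fun XY => (XY.1 \o i, XY.2 \o i)); split.
- move=> [X Y] [/= tXY Yil YS].
  exact: (torsion_pair_restrict l_adj_i l_exact i_ff tXY Yil YS).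
(* Injectivity: the restriction determines the torsion-free class, whose left orthogonal is the
   torsion class. *)
- move=> [X Y] [X' Y'] /set_mem [/= tXY Yil YS]
    /set_mem [/= tXY' Yil' YS'] [_ YY'].
  have EY := torsion_free_restrictK l_adj_i l_exact i_ff tXY Yil YS.
  have EY' := torsion_free_restrictK l_adj_i l_exact i_ff tXY' Yil' YS'.
  have YE : Y = Y' by rewrite EY YY' -EY'.
  have [-> _] := torsion_pair_orth tXY; have [-> _] := torsion_pair_orth tXY'.
  by rewrite YE.
- move=> [T F] /= tTF; have [TE FE] := torsion_pair_orth tTF.
  (* Both classes are orthogonals, hence invariant under the counit isomorphism. *)
  have liT B : T (l (i B)) <-> T B.
    rewrite TE; have lB := li_iso l_adj_i i_ff B.
    by split; apply: left_orth_iso => //; exact: isomorphic_sym.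
  have liF B : F (l (i B)) <-> F B.
    rewrite FE; have lB := li_iso l_adj_i i_ff B.
    by split; apply: right_orth_iso => //; exact: isomorphic_sym.
  exists (T \o l, (F \o l) `&` right_orth (Ker l)) => /=; first split.
  + exact: (torsion_pair_extend l_adj_i l_exact i_ff tTF).
  + move=> Y [/= FY _]; split; first exact/liF.
    exact: (right_orth_Ker_i l_adj_i l_exact).
  + by move=> Y [].
  (* The restriction of the extended pair is the original one: [l (i B)] is isomorphic to [B], and
     [i B] always lies in [right_orth (Ker l)]. *)
  + congr pair; apply/seteqP; split=> B /=.
    * exact: (liT B).1.
    * exact: (liT B).2.
    * by case=> /liF.
    * by move=> FB; split; [exact/liF|exact: (right_orth_Ker_i l_adj_i l_exact)].
Qed.
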